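(* Let $n$ and $k$ be integers with $k\ge 2$. If $n\ge 7k-5$, then the mutual-visibility number of the Kneser graph $KG(n,k)$ is $$\mu(KG(n,k))=\binom{n}{k}-C^*(n,k),$$ where $C^*(n,k)=C(n,n-k,2k-1)$ is a covering number. In particular, if $n\ge 2k^2$ (and $k \ge 2$), then $$\mu(KG(n,k))=\binom{n}{k}-2k.$$
   Context: Kneser graph: $KG(n,k)$ has as vertices the $k$-element subsets of $[n]=\{1,\dots,n\}$; two vertices $A,B$ are adjacent if and only if $A\cap B=\emptyset$. Mutual-visibility: Let $G$ be a connected graph and $\mathcal X\subseteq V(G)$. Two vertices $u,v\in V(G)$ are $\mathcal X$-visible if there is a shortest $u,v$-path $P$ in $G$ with no internal vertex in $\mathcal X$, i.e. $V(P)\cap\mathcal X\subseteq\{u,v\}$. The set $\mathcal X$ is a mutual-visibility set if any two vertices of $\mathcal X$ are $\mathcal X$-visible. The mutual-visibility number $\mu(G)$ is the largest cardinality of a mutual-visibility set in $G$. Covering number: For positive integers $n\ge m\ge t$, $C(n,m,t)$ is the minimum number of blocks in a collection $\mathcal B$ of $m$-element subsets (blocks) of an $n$-element set $X$ such that every $t$-element subset of $X$ is contained in at least one block of $\mathcal B$. *)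

(* Defs.v *)
From mathcomp Require Import all_boot all_order all_algebra.
From mathcomp Require Import boolp.

Set Implicit Arguments.
Unset Strict Implicit.
Unset Printing Implicit Defensive.

Section MutualVisibility.

Variables (T : finType) (e : rel T).

(* A path from [u] to [v] is encoded by the list [p] of its vertices
   other than [u]; its length is therefore [size p]. *)
Definition is_path (u v : T) (p : seq T) : bool :=
  [&& path e u p, last u p == v & uniq (u :: p)].

Definition is_shortest_path (u v : T) (p : seq T) : Prop :=
  is_path u v p /\ forall q, is_path u v q -> size p <= size q.

Definition visible (X : {set T}) (u v : T) : Prop :=
  exists2 p, is_shortest_path u v p &
    forall w, w \in u :: p -> w \in X -> w = u \/ w = v.

Definition mutual_visibility_set (X : {set T}) : Prop :=
  {in X &, forall u v, visible X u v}.

Definition mutual_visibility_number : nat :=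
  \max_(X : {set T} | `[< mutual_visibility_set X >]) #|X|.

End MutualVisibility.

Definition kneser (n k : nat) : rel {A : {set 'I_n} | #|A| == k} :=
  fun A B => [disjoint val A & val B].

Definition is_covering (n m t : nat) (B : {set {set 'I_n}}) : bool :=
  [forall b in B, #|b| == m] &&
  [forall s : {set 'I_n}, (#|s| == t) ==> [exists b in B, s \subset b]].

(* The neutral value ['C(n, m)] of the minimum is the size of the family of all
   [m]-subsets, which is itself a covering whenever [t <= m <= n]; hence in that
   range this is the minimum over all coverings. *)
Definition covering_number (n m t : nat) : nat :=
  \big[minn/'C(n, m)]_(B : {set {set 'I_n}} | is_covering m t B) #|B|.

Definition Cstar (n k : nat) : nat := covering_number n (n - k) (2 * k - 1).

(* Main.v *)
Require Import Defs.
From mathcomp Require Import all_boot all_order all_algebra.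
From mathcomp Require Import boolp zify.

Set Implicit Arguments.
Unset Strict Implicit.
Unset Printing Implicit Defensive.

(** Let n >= 3k-1, so that two distinct intersecting k-sets A and B are at
    distance 2 in the Kneser graph, and the shortest paths between them are the
    paths through a k-set disjoint from A :|: B.  Hence X is a mutual-visibility
    set exactly when its complement F in the vertex set satisfies: any two
    distinct intersecting k-sets outside F admit a member of F disjoint from
    both ([links_missing_pairs]).  As #|A :|: B| <= 2k-1, this certainly holds
    when no (2k-1)-set meets all the members of F, that is, when F has
    transversal number at least 2k ([unhittable (2 * k) F]); and, taking
    complements, such families F of k-sets are the same thing as coverings with
    parameters (n, n-k, 2k-1).  This gives mu >= 'C(n, k) - C*.

    For the converse, suppose that F satisfies the visibility condition although
    some S with 2k-1 elements meets every member of F.  Two k-subsets A and B of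
    S with A :|: B = S share one point and cannot both be missing from F, because
    the member of F linking them would avoid S.  The graph of these pairs on the
    k-subsets of S is regular, so F contains at least half of the k-subsets of S
    ([hitting_half]).  If at least k members of F are not contained in S, then
    'C(2k-1, k) + 2k <= 2 #|F|.  Otherwise k-1 points outside S meet all of those,
    and S can be replaced by these points together with any k-subset K of S, as K
    meets every k-subset of S.  The new set again has at least half of its
    k-subsets in F, and too few are available unless K itself is one of them.
    Then every k-subset of S is in F, and the same bound holds with room to spare
    ([hittable_card]).

    It remains to see that C* is no larger than this bound.  The k-subsets of a
    (k-1+t)-set have transversal number t, and transversal numbers add up over
    disjoint ground sets ([unhittable_family]).  Five blocks with the t's close
    to 2k/5 use 5(k-1) + 2k = 7k-5 points, and give few enough sets since the
    binomials involved are exponentially smaller than 'C(2k-1, k)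
    ([sum_bin_fifths]).  With 2k blocks and every t equal to 1, which needs 2k^2
    points, one gets 2k disjoint k-sets, and fewer than 2k nonempty sets can always
    be met by 2k-1 points, so that C* = 2k. *)

(** * Hitting sets of uniform families *)

Section Families.
Variable T : finType.
Implicit Types (A B C S U : {set T}) (F : {set {set T}}).

Definition uniform k F := {in F, forall A, #|A| = k}.
(** The transversal number of [F] is at least [t]. *)
Definition unhittable t F :=
  forall S, #|S| < t -> exists2 C, C \in F & [disjoint C & S].

Lemma disjoint_setUr A B C :
  [disjoint C & A :|: B] = [disjoint C & A] && [disjoint C & B].
Proof. by rewrite -!setI_eq0 setIUr setU_eq0. Qed.

Lemma subset_of_card m U : m <= #|U| -> exists2 A : {set T}, A \subset U & #|A| = m.
Proof.
move=> le_mU.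
have : 0 < #|[set A : {set T} | (A \subset U) && (#|A| == m)]|.
  by rewrite cards_draws bin_gt0.
by case/card_gt0P=> A; rewrite inE => /andP[AU /eqP Am]; exists A.
Qed.

Lemma superset_of_card m S U : S \subset U -> #|S| <= m <= #|U| ->
  exists A : {set T}, [/\ S \subset A, A \subset U & #|A| = m].
Proof.
move=> SU /andP[leSm lemU].
have cU : #|U :\: S| = #|U| - #|S| by rewrite cardsD (setIidPr SU).
have [|A AU cA] := @subset_of_card (m - #|S|) (U :\: S).
  by rewrite cU leq_sub2r.
exists (S :|: A); move: AU; rewrite subsetD => /andP[AU dAS].
split; [exact: subsetUl | by rewrite subUset SU | ].
by rewrite cardsU disjoint_setI0 1?disjoint_sym // cards0 cA; lia.
Qed.

(** One point is chosen in each member of [F]. *)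
Lemma hitting_set F : (forall A, A \in F -> A != set0) ->
  exists S : {set T}, #|S| <= #|F| /\ forall A, A \in F -> ~~ [disjoint A & S].
Proof.
move=> F0; case: (pickP (mem [set: T])) => [x0 _ | T0]; last first.
  exists set0; split=> [|A /F0 /set0Pn[x _]]; first by rewrite cards0.
  by have := T0 x; rewrite /= inE.
pose f A := odflt x0 [pick x in A].
exists (f @: F); split=> [|A AF]; first exact: leq_imset_card.
apply/pred0Pn; exists (f A); rewrite /= imset_f // andbT.
rewrite /f; case: pickP => [//|A0]; case/set0Pn: (F0 A AF) => x.
by have := A0 x; rewrite /= => ->.
Qed.

Lemma unhittable_card k t F : 0 < k -> uniform k F -> unhittable t F -> t <= #|F|.
Proof.
move=> k0 uF hF; rewrite leqNgt; apply/negP => ltFt.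
have [A AF|S [leSF hS]] := @hitting_set F; first by rewrite -card_gt0 uF.
have [|C CF dCS] := hF S; first exact: leq_ltn_trans ltFt.
by have := hS C CF; rewrite dCS.
Qed.

(** Disjoint blocks of [k.-1 + t] points are cut out of [U], one for each entry
    [t] of [ts], and all the [k]-subsets of the blocks are taken.  A set smaller
    than the sum of [ts] meets some block in fewer than [t] points, and thus leaves
    at least [k] points of that block free. *)
Lemma unhittable_family k (ts : seq nat) U : 0 < k ->
  \sum_(t <- ts) (k.-1 + t) <= #|U| ->
  exists F, [/\ uniform k F, {in F, forall A, A \subset U},
    #|F| <= \sum_(t <- ts) 'C(k.-1 + t, k) & unhittable (\sum_(t <- ts) t) F].
Proof.
move=> k0; elim: ts U => [|t ts IH] U; rewrite ?(big_nil, big_cons) => leU.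
  exists set0; split=> [A|A||S]; rewrite ?inE ?cards0 ?big_nil //.
have [|P PU cP] := @subset_of_card (k.-1 + t) U.
  exact: leq_trans (leq_addr _ _) leU.
have [|F [uF FU cF hF]] := IH (U :\: P).
  by rewrite cardsD (setIidPr PU) cP; lia.
pose G := [set A : {set T} | A \subset P & #|A| == k].
exists (F :|: G); split.
- by move=> A; rewrite !inE => /orP[/uF //|/andP[_ /eqP]].
- move=> A; rewrite !inE => /orP[/FU|/andP[AP _]]; last exact: subset_trans PU.
  by move/subset_trans; apply; exact: subsetDl.
- by rewrite (leq_trans (leq_card_setU _ _)) // cards_draws cP addnC leq_add2l.
move=> S ltS; have [ltSP|leSP] := ltnP #|S :&: P| t.
  have [|A APS cA] := @subset_of_card k (P :\: S).
    by rewrite cardsD setIC cP; lia.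
  move: APS; rewrite subsetD => /andP[AP dAS].
  by exists A; rewrite // !inE AP cA eqxx orbT.
have [|C CF dC] := hF (S :\: P); first by have := cardsID P S; lia.
exists C; first by rewrite inE CF.
have /FU := CF; rewrite subsetD => /andP[_ dCP].
by rewrite -(setID S P) disjoint_setUr dC andbT (disjointWr _ dCP) ?subsetIr.
Qed.

(** The trace of mutual visibility on the family [F] of non-selected vertices:
    the set [C] is the middle vertex of a path of length two from [A] to [B]. *)
Definition links_missing_pairs k F :=
  forall A B, #|A| = k -> #|B| = k -> A \notin F -> B \notin F ->
    A != B -> ~~ [disjoint A & B] ->
  exists C, [/\ C \in F, [disjoint C & A] & [disjoint C & B]].

(** For each point [a] of [S], the involution [A |-> a |: (S :\: A)] acts on the
    [k]-subsets of [S] containing [a].  It pairs sets that cover [S] and meet in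
    [a] alone, so it maps the missing ones to members of [F].  Summing over [a]
    counts every set [k] times. *)
Lemma hitting_half k F S : 1 < k -> links_missing_pairs k F ->
  #|S| = 2 * k - 1 -> (forall C, C \in F -> ~~ [disjoint C & S]) ->
  'C(2 * k - 1, k) <= 2 * #|[set A in F | (A \subset S) && (#|A| == k)]|.
Proof.
move=> k1 lF cS hS; set W := [set A in F | _].
pose Z := [set A : {set T} | A \subset S & #|A| == k] :\: F.
have cZW : #|Z| + #|W| = 'C(2 * k - 1, k).
  rewrite -cS -cards_draws addnC -[RHS](cardsID F); congr (_ + _).
  by apply: eq_card => A; rewrite !inE andbC.
suff : #|Z| <= #|W| by lia.
(* Double counting of the incidences between points and members of Q. *)
have dc (Q : {set {set T}}) : uniform k Q ->
    #|Q| * k = \sum_(a : T) #|[set A in Q | a \in A]|.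
  move=> uQ; rewrite -sum_nat_const.
  transitivity (\sum_(A in Q) \sum_(a : T | a \in A) 1).
    by apply: eq_bigr => A AQ; rewrite sum1_card uQ.
  rewrite (exchange_big_dep xpredT) //=; apply: eq_bigr => a _.
  by rewrite sum1dep_card.
have uZ : uniform k Z by move=> A; rewrite !inE => /and3P[_ _ /eqP].
have uW : uniform k W by move=> A; rewrite !inE => /and3P[_ _ /eqP].
rewrite -(leq_pmul2r (ltnW k1)) !dc //; apply: leq_sum => a _.
pose phi A := a |: (S :\: A).
have phiK : {in [set A in Z | a \in A], cancel phi phi}.
  move=> A; rewrite !inE => /andP[/and3P[_ AS _] aA].
  apply/setP=> x; rewrite !inE; case: eqP => [->|_] /=; first by rewrite aA.
  by have := subsetP AS x; case: (x \in A) => [->|] //; case: (x \in S).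
rewrite -(card_in_imset (can_in_inj phiK)); apply: subset_leq_card.
apply/subsetP=> _ /imsetP[A + ->]; rewrite !inE => /andP[/and3P[AF AS cA] aA].
rewrite eqxx andbT.
have aS := subsetP AS a aA.
have phiS : phi A \subset S by rewrite subUset sub1set aS subsetDl.
have cphi : #|phi A| = k.
  rewrite cardsU1 !inE aA /= cardsD (setIidPr AS) cS (eqP cA); lia.
rewrite phiS cphi eqxx !andbT; apply/negPn/negP => phiF.
have [||C [CF dCA dCphi]] := lF A (phi A) (eqP cA) cphi AF phiF.
- apply/eqP=> eA; have : A \subset [set a].
    apply/subsetP=> x xA; have : x \in phi A by rewrite -eA.
    by rewrite !inE xA /= orbF.
  by move/subset_leq_card; rewrite cards1 (eqP cA) leqNgt k1.
- by apply/pred0Pn; exists a; rewrite /= aA !inE eqxx.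
have := hS C CF; rewrite -(setID S A) disjoint_setUr (disjointWr _ dCA) ?subsetIr //.
by rewrite (disjointWr _ dCphi) ?subsetUr.
Qed.

Lemma bin_mid_ge k : 1 < k -> 2 * k - 1 <= 'C(2 * k - 1, k).
Proof.
case: k => [|[|k]] // _; elim: k => // k IH.
have -> : 2 * k.+3 - 1 = (2 * k.+2 - 1).+2 by lia.
have : 3 <= 2 * k.+2 - 1 by lia.
move: (2 * k.+2 - 1) IH => m IH m3; rewrite !binS.
have := bin_gt0 m k.+1; lia.
Qed.

Lemma hitting_set_of_card t F : 0 < t <= #|T| -> ~ unhittable t F ->
  exists2 S : {set T}, #|S| = t.-1 & forall C, C \in F -> ~~ [disjoint C & S].
Proof.
move=> /andP[t0 leT] nhF.
have [|] := boolP [exists S : {set T},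
    (#|S| == t.-1) && [forall C in F, ~~ [disjoint C & S]]].
  by case/existsP=> S /andP[/eqP cS /forall_inP hS]; exists S.
rewrite negb_exists => /forallP nS; case: nhF => S ltS.
have [|S' [SS' _ cS']] := @superset_of_card t.-1 S setT (subsetT _).
  by rewrite cardsT; lia.
have := nS S'; rewrite cS' eqxx negb_forall => /existsP[C].
rewrite negb_imply negbK => /andP[CF dC]; exists C => //.
exact: disjointWr dC.
Qed.

(** If fewer than [k] members of [F] leave [S], they are all met by some [k.-1]
    points [R] outside [S], and [hitting_half] applies to [K :|: R] for every
    [k]-subset [K] of [S].  The only members of [F] that can lie in [K :|: R] are
    [K] and those leaving [S]; the latter are less than half of
    ['C(2 * k - 1, k)], so [K] must be in [F] for every [K].  Then [F] contains
    all the [k]-subsets of [S], instead of half of them. *)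
Lemma hittable_card k F : 1 < k -> 3 * k - 2 <= #|T| -> uniform k F ->
  links_missing_pairs k F -> ~ unhittable (2 * k) F ->
  'C(2 * k - 1, k) + 2 * k <= 2 * #|F|.
Proof.
move=> k1 leT uF lF nhF.
have [||S cS hS] := @hitting_set_of_card (2 * k) F => //; first by lia.
rewrite -subn1 in cS.
have := hitting_half k1 lF cS hS; set FS := [set A in F | _] => halfS.
pose FO := F :\: FS.
have cF : #|F| = #|FS| + #|FO|.
  rewrite -(cardsID FS F) (setIidPr _) //.
  by apply/subsetP=> A; rewrite inE => /andP[].
have [ltO|] := ltnP #|FO| k; last by lia.
have [R [RS cR hR]] : exists R : {set T}, [/\ R \subset ~: S, #|R| = k.-1 &
    forall A, A \in FO -> ~~ [disjoint A & R]].
  have [_ /imsetP[A + ->]|R [cR hR]] :=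
    @hitting_set [set A :\: S | A : {set T} in FO].
    rewrite !inE => /andP[+ AF].
    by rewrite AF uF // eqxx andbT -setD_eq0.
  have {}cR := leq_trans cR (leq_imset_card _ _).
  have cRS := subset_leq_card (subsetIl R (~: S)).
  have [||R' [RR' R'S cR']] := @superset_of_card k.-1 (R :&: ~: S) (~: S).
  - exact: subsetIr.
  - rewrite (leq_trans cRS) /=; last first.
      by rewrite -ltnS (leq_ltn_trans cR) ?prednK ?(ltnW k1).
    by rewrite [#|~: S|]cardsCs setCK cS; lia.
  exists R'; split=> // A AO; have := hR _ (imset_f (fun A => A :\: S) AO).
  apply: contraNN => dAR'; apply/pred0P => x /=; rewrite !inE.
  apply/negP=> /andP[/andP[xS xA] xR].
  have /pred0P/(_ x)/= := dAR'; rewrite xA (subsetP RR') //.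
  by rewrite !inE xR xS.
have halfR (K : {set T}) : K \subset S -> #|K| = k ->
    'C(2 * k - 1, k) <= 2 * ((K \in F) + #|FO|).
  move=> KS cK; pose S' := K :|: R.
  have dKR : [disjoint K & R].
    by rewrite (disjointWl KS) // disjoint_sym disjoints_subset.
  have cS' : #|S'| = 2 * k - 1.
    by rewrite cardsU disjoint_setI0 // cards0 cK cR; lia.
  have hS' C : C \in F -> ~~ [disjoint C & S'].
    move=> CF; have [CFS|CFS] := boolP (C \in FS); last first.
      have CO : C \in FO by rewrite inE CFS.
      by apply: contraNN (hR C CO) => /disjointWr; apply; apply: subsetUr.
    apply/negP=> /(disjointWr (subsetUl K R)) dCK.
    have : #|C :|: K| <= #|S|.
      apply: subset_leq_card; rewrite subUset KS andbT.
      by move: CFS; rewrite inE => /and3P[].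
    by rewrite cardsU disjoint_setI0 // cards0 cK cS uF //; lia.
  apply: leq_trans (hitting_half k1 lF cS' hS') _; rewrite leq_mul2l /=.
  have -> : (K \in F) + #|FO| = #|F :&: [set K]| + #|FO|.
    congr (_ + _); case: (boolP (K \in F)) => KF; last first.
      by rewrite setIC disjoint_setI0 ?cards0 // disjoints1.
    by rewrite (setIidPr _) ?cards1 // sub1set.
  apply: leq_trans (leq_card_setU _ _); apply: subset_leq_card.
  apply/subsetP=> A; rewrite !inE => /and3P[AF AS' cA].
  rewrite AF cA !andbT /=; have [AS|_] := boolP (A \subset S); last by rewrite orbT.
  rewrite orbF eqEcard (eqP cA) cK leqnn andbT.
  apply/subsetP=> x xA; have := subsetP AS' x xA; rewrite inE => /orP[//|xR].
  by have := subsetP RS x xR; rewrite inE (subsetP AS).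
have mid := bin_mid_ge k1.
have [allF|] := boolP ([set A : {set T} | A \subset S & #|A| == k] \subset F).
  have cFS : #|FS| = 'C(2 * k - 1, k).
    rewrite -cS -cards_draws; apply: eq_card => B; rewrite !inE.
    case: (boolP (B \in F)) => //= BF; apply/esym/negbTE.
    by apply: contraNN BF => BS; rewrite (subsetP allF) // inE.
  have [|K KS cK] := @subset_of_card k S; first by lia.
  by have := halfR K KS cK; case: (K \in F); lia.
case/subsetPn=> K; rewrite inE => /andP[KS /eqP cK] KF.
by have := halfR K KS cK; rewrite (negbTE KF); lia.
Qed.

End Families.

(** * Binomial estimates *)

Lemma double_bin_pred m k : 0 < m < 2 * k -> 2 * 'C(m.-1, k) <= 'C(m, k).
Proof.
case: m k => // m [|k]; first by lia.
move=> /= lt_mk; rewrite binS mul2n -addnn leq_add2l.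
rewrite -(@leq_pmul2l k.+1) // mul_bin_left leq_mul2r; apply/orP; right; lia.
Qed.

(** Each step from [2 * k - 1] downwards at least halves the binomial. *)
Lemma bin_sub_pow2 k d : d < 2 * k ->
  2 ^ d * 'C(2 * k - 1 - d, k) <= 'C(2 * k - 1, k).
Proof.
elim: d => [|d IH] ltd; first by rewrite mul1n subn0.
apply: leq_trans (IH (ltnW ltd)); rewrite expnSr -mulnA leq_mul2l subnS.
by rewrite double_bin_pred ?orbT //; lia.
Qed.

(** An almost even splitting of [2 * k] into five parts; the identity
    [sum_fifths] is Hermite's identity for the floor function. *)
Definition fifths k := [seq (2 * k + i) %/ 5 | i <- iota 0 5].

Lemma sum_fifths k : \sum_(t <- fifths k) t = 2 * k.
Proof. rewrite /fifths /= !big_cons big_nil; lia. Qed.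

(** For [7 <= k] every part is at most [k - 4], so each of the five binomials is
    at most a sixteenth of ['C(2 * k - 1, k)], and [2 * 5 <= 16].  The smaller
    values of [k], where the inequality is tight for [k = 2] and [k = 3] up to the
    rounding, are computed. *)
Lemma sum_bin_fifths k : 1 < k ->
  2 * \sum_(t <- fifths k) 'C(k.-1 + t, k) <= 'C(2 * k - 1, k) + 2 * k + 1.
Proof.
move=> k1; have [k7|] := leqP 7 k; last first.
  by case: k k1 => [|[|[|[|[|[|[|k]]]]]]] // _ _; rewrite /fifths unlock.
have bound t : t <= k - 4 -> 16 * 'C(k.-1 + t, k) <= 'C(2 * k - 1, k).
  move=> let4; apply: leq_trans (@bin_sub_pow2 k 4 _); last by lia.
  by rewrite leq_mul2l leq_bin2l //; lia.
have := bound ((2 * k + 4) %/ 5); have := bound ((2 * k + 3) %/ 5).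
have := bound ((2 * k + 2) %/ 5); have := bound ((2 * k + 1) %/ 5).
have := bound ((2 * k + 0) %/ 5).
rewrite /fifths /= !big_cons big_nil.
set a := 'C(_, _); set b := 'C(_, _); set c := 'C(_, _); set d := 'C(_, _).
set e := 'C(_, _).
lia.
Qed.

(** * Shortest paths of length one and two *)

Lemma shortest_adj (T : finType) (e : rel T) u v :
  u != v -> e u v -> is_shortest_path e u v [:: v].
Proof.
move=> uv euv; split=> [|[|//]]; rewrite /is_path /= ?euv ?inE ?uv ?eqxx //.
by rewrite (negbTE uv).
Qed.

Lemma shortest_dist2 (T : finType) (e : rel T) u v w :
  uniq [:: u; w; v] -> ~~ e u v -> e u w -> e w v ->
  is_shortest_path e u v [:: w; v].
Proof.
move=> uq nuv uw wv; split; first by rewrite /is_path /= uw wv eqxx.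
case=> [|x [|//]]; rewrite /is_path /=.
  by move: uq; rewrite /= !inE negb_or => /andP[/andP[_ /negbTE->]].
by case/and3P=> /andP[ux _] /eqP xv; rewrite xv (negbTE nuv) in ux.
Qed.

(** * Visibility in Kneser graphs *)

Section Kneser.
Variables n k : nat.
Hypothesis k2 : 1 < k.
Implicit Types (A B C S : {set 'I_n}) (F Q : {set {set 'I_n}}).
Local Notation kset := {A : {set 'I_n} | #|A| == k}.

Lemma unhittable_covering F : k <= n -> uniform k F -> unhittable (2 * k) F ->
  is_covering (n - k) (2 * k - 1) [set ~: C | C in F].
Proof.
move=> kn uF hF; apply/andP; split.
  by apply/forall_inP=> _ /imsetP[C CF ->]; rewrite cardsCs setCK card_ord uF.
apply/forallP=> S; apply/implyP=> /eqP cS.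
have [|C CF dCS] := hF S; first by rewrite cS; lia.
apply/exists_inP; exists (~: C); first exact: imset_f.
by rewrite -disjoints_subset disjoint_sym.
Qed.

Lemma covering_unhittable Q : 2 * k - 1 <= n ->
    is_covering (n - k) (2 * k - 1) Q ->
  uniform k [set ~: C | C in Q] /\ unhittable (2 * k) [set ~: C | C in Q].
Proof.
move=> kn /andP[/forall_inP uQ /forallP cQ]; split=> [_ /imsetP[C CQ ->]|S ltS].
  by rewrite cardsCs setCK card_ord (eqP (uQ C CQ)); lia.
have [|S' [SS' _ cS']] := @superset_of_card _ (2 * k - 1) S [set: 'I_n] (subsetT _).
  by rewrite cardsT card_ord; lia.
have := cQ S'; rewrite cS' eqxx => /exists_inP[C CQ S'C].
exists (~: C); first exact: imset_f.
by rewrite disjoint_sym disjoints_subset setCK (subset_trans SS').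
Qed.

Lemma Cstar_le Q : is_covering (n - k) (2 * k - 1) Q -> Cstar n k <= #|Q|.
Proof.
rewrite /Cstar /covering_number => cQ; have := mem_index_enum Q.
elim: (index_enum _) => // B r IH; rewrite big_cons inE.
case: eqP => [<- _|_ /= /IH leQ]; first by rewrite cQ geq_minl.
by case: ifP => // _; rewrite geq_min leQ orbT.
Qed.

Lemma le_Cstar m : k <= n -> m <= 'C(n, k) ->
  (forall Q : {set {set 'I_n}}, is_covering (n - k) (2 * k - 1) Q -> m <= #|Q|) ->
  m <= Cstar n k.
Proof.
move=> kn lem leQ; rewrite /Cstar /covering_number.
elim/big_ind: _ => // [|x y mx my]; first by rewrite bin_sub.
by rewrite leq_min mx.
Qed.

Lemma Cstar_le_sum (ts : seq nat) : k <= n ->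
  \sum_(t <- ts) t = 2 * k -> \sum_(t <- ts) (k.-1 + t) <= n ->
  Cstar n k <= \sum_(t <- ts) 'C(k.-1 + t, k).
Proof.
move=> kn sumt len.
have [|F [uF _ cF]] := @unhittable_family _ k ts [set: 'I_n] (ltnW k2).
  by rewrite cardsT card_ord.
rewrite sumt => hF; apply: leq_trans cF.
apply: leq_trans (Cstar_le (unhittable_covering kn uF hF)) _.
exact: leq_imset_card.
Qed.

Lemma Cstar_ge_double : 2 * k <= n -> 2 * k <= Cstar n k.
Proof.
move=> kn; apply: le_Cstar => [||Q cQ]; first by lia.
  apply: leq_trans (leq_bin2l k kn).
  have := binS (2 * k).-1 k.-1; rewrite !prednK; [|lia..] => ->.
  by have := bin_mid_ge k2; have := bin_gt0 (2 * k).-1 k.-1; rewrite subn1; lia.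
have [|uQ hQ] := covering_unhittable _ cQ; first by lia.
exact: leq_trans (unhittable_card (ltnW k2) uQ hQ) (leq_imset_card _ _).
Qed.

Lemma kset_disjoint_neq (u v : kset) : [disjoint val u & val v] -> u != v.
Proof.
apply: contraTneq => ->; rewrite -setI_eq0 setIid -card_gt0.
by rewrite (eqP (valP v)); lia.
Qed.

Definition missing (X : {set kset}) : {set {set 'I_n}} := val @: ~: X.

Lemma card_missing X : #|missing X| + #|X| = 'C(n, k).
Proof.
rewrite card_imset; last exact: val_inj.
rewrite addnC cardsC card_sig -[n in RHS]card_ord -card_draws.
by apply: eq_card => A; rewrite !inE.
Qed.

(** A shortest path between intersecting vertices has exactly two edges, as the
    bound on [n] leaves room for a [k]-set disjoint from both; its middle vertex
    is internal, hence outside [X]. *)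
Lemma visible_links (X : {set kset}) : 3 * k - 1 <= n ->
  mutual_visibility_set (@kneser n k) X -> links_missing_pairs k (missing X).
Proof.
move=> kn vX A B cA cB AX BX AB nd.
pose u : kset := Sub A (introT eqP cA); pose v : kset := Sub B (introT eqP cB).
have inX C (cC : #|C| == k) : C \notin missing X -> (Sub C cC : kset) \in X.
  by apply: contraR => CX; apply/imsetP; exists (Sub C cC); rewrite ?inE.
have uv : u != v by rewrite -val_eqE.
have nuv : ~~ kneser u v by [].
have [p [pp pmin] pX] := vX u v (inX A _ AX) (inX B _ BX).
have [|C CAB cC] := @subset_of_card _ k (~: (A :|: B)).
  rewrite cardsCs setCK card_ord cardsU.
  have : 0 < #|A :&: B| by rewrite card_gt0 setI_eq0.
  lia.
move: CAB; rewrite -disjoints_subset disjoint_setUr => /andP[dCA dCB].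
pose w : kset := Sub C (introT eqP cC).
have wu : w != u by apply: kset_disjoint_neq.
have wv : w != v by apply: kset_disjoint_neq.
have := pmin [:: w; v]; rewrite /is_path /= /kneser /= disjoint_sym dCA dCB.
rewrite eqxx !inE negb_or uv wv eq_sym wu => /(_ isT).
case: p pp {pmin} pX => [|x [|y [|//]]]; rewrite /is_path /=.
- by rewrite (negbTE uv).
- by case/and3P=> /andP[ux _] /eqP xv; rewrite xv (negbTE nuv) in ux.
rewrite andbT => /and3P[/andP[ux xy] /eqP yv _] pX _; rewrite yv in xy.
exists (val x); split; last by [].
  apply: imset_f; rewrite inE; apply/negP => /pX [|xu|xv].
  - by rewrite !inE eqxx orbT.
  - by have := kset_disjoint_neq ux; rewrite xu eqxx.
  - by have := kset_disjoint_neq xy; rewrite xv eqxx.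
by rewrite disjoint_sym.
Qed.

(** Intersecting [k]-sets have a union of less than [2 * k] points, which
    therefore misses some member of [F]. *)
Lemma unhittable_visible F : unhittable (2 * k) F -> uniform k F ->
  mutual_visibility_set (@kneser n k) [set u | val u \notin F].
Proof.
move=> hF uF u v; rewrite !inE => uF' vF'.
have [<-|uv] := eqVneq u v.
  exists [::]; last by move=> w; rewrite inE => /eqP; left.
  by split=> //; rewrite /is_path /= eqxx.
have [euv|nuv] := boolP (kneser u v).
  exists [:: v]; first exact: shortest_adj.
  by move=> w; rewrite !inE => /orP[]/eqP; auto.
have [|C CF] := hF (val u :|: val v).
  have : 0 < #|val u :&: val v| by rewrite card_gt0 setI_eq0.
  by rewrite cardsU (eqP (valP u)) (eqP (valP v)); lia.
rewrite disjoint_setUr => /andP[dCu dCv].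
pose w : kset := Sub C (introT eqP (uF C CF)).
have wu : w != u by apply: kset_disjoint_neq.
have wv : w != v by apply: kset_disjoint_neq.
exists [:: w; v].
  apply: shortest_dist2 => //; last by rewrite /kneser disjoint_sym.
  by rewrite /= !inE negb_or uv eq_sym wu wv.
move=> x; rewrite !inE => /or3P[]/eqP->; auto.
by rewrite CF.
Qed.

Lemma mutual_visibility_number_ge : 3 * k - 1 <= n ->
  'C(n, k) - mutual_visibility_number (@kneser n k) <= Cstar n k.
Proof.
move=> kn; apply: le_Cstar => [||Q cQ]; [lia | exact: leq_subr | ].
have [|uF hF] := covering_unhittable _ cQ; first by lia.
apply: leq_trans (leq_imset_card (fun C => ~: C) Q).
set F := _ @: _ in uF hF *.
set X : {set kset} := [set u | val u \notin F].
have XF : #|missing X| <= #|F|.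
  apply/subset_leq_card/subsetP=> _ /imsetP[u + ->].
  by rewrite !inE negbK.
have leX : #|X| <= mutual_visibility_number (@kneser n k).
  by apply: leq_bigmax_cond; apply/asboolP; apply: unhittable_visible.
by have := card_missing X; lia.
Qed.

(** Either the missing vertices give a covering, whose size is at least [Cstar],
    or [hittable_card] bounds their number from below.  The [+ 1] on the right
    takes care of parity: [2 * m] and [2 * #|missing X|] are both even. *)
Lemma mutual_visibility_number_le m : 3 * k - 1 <= n -> m <= Cstar n k ->
  2 * m <= 'C(2 * k - 1, k) + 2 * k + 1 ->
  mutual_visibility_number (@kneser n k) + m <= 'C(n, k).
Proof.
move=> kn mC mh.
(* The bound for the empty set X makes the subtraction of m exact. *)
suff key (X : {set kset}) : mutual_visibility_set (@kneser n k) X ->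
    #|X| + m <= 'C(n, k).
  have /key : mutual_visibility_set (@kneser n k) set0 by move=> u v; rewrite inE.
  rewrite cards0 => le_mC; rewrite addnC -leq_subRL //.
  by apply/bigmax_leqP => X /asboolP /key; rewrite leq_subRL // addnC.
move=> vX; suff : m <= #|missing X| by have := card_missing X; lia.
have uX : uniform k (missing X) by move=> _ /imsetP[u _ ->]; exact/eqP/(valP u).
have [hX|hX] := EM (unhittable (2 * k) (missing X)).
  apply: leq_trans mC (leq_trans _ (leq_imset_card (fun C => ~: C) _)).
  by apply: Cstar_le; apply: unhittable_covering => //; lia.
have := hittable_card k2 _ uX (visible_links kn vX) hX.
by rewrite card_ord => /(_ ltac:(lia)); lia.
Qed.

End Kneser.

Local Open Scope ring_scope.

Theorem theorem5 (n k : nat) (hk : (2 <= k)%N) :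
  ((7 * k - 5 <= n)%N ->
     (mutual_visibility_number (@kneser n k))%:Z
     = 'C(n, k)%:Z - (Cstar n k)%:Z)
  /\
  ((2 * k ^ 2 <= n)%N ->
     (mutual_visibility_number (@kneser n k))%:Z
     = 'C(n, k)%:Z - (2 * k)%N%:Z).
Proof.
split=> len.
  have kn : (3 * k - 1 <= n)%N by lia.
  have := mutual_visibility_number_ge hk kn.
  have leC : (Cstar n k <= \sum_(t <- fifths k) 'C(k.-1 + t, k))%N.
    apply: Cstar_le_sum; rewrite ?sum_fifths //; first lia.
    by rewrite /fifths unlock /=; lia.
  have := mutual_visibility_number_le hk kn (leqnn _).
  by have := sum_bin_fifths hk; lia.
have kn : (3 * k - 1 <= n)%N by move: len; rewrite expnS expn1; nia.
have CE : Cstar n k = (2 * k)%N.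
  apply/eqP; rewrite eqn_leq; apply/andP; split.
    apply: leq_trans (@Cstar_le_sum n k hk (nseq (2 * k) 1) _ _ _) _.
    - lia.
    - by rewrite big_nseq iter_addn_0 mul1n.
    - by rewrite big_nseq iter_addn_0; move: len; rewrite expnS expn1; nia.
    - by rewrite big_nseq iter_addn_0 addn1 prednK ?binn ?mul1n // ltnW.
  by apply: Cstar_ge_double => //; lia.
have := mutual_visibility_number_ge hk kn.
have := mutual_visibility_number_le hk kn (leqnn _).
by have := bin_mid_ge hk; rewrite CE; lia.
Qed.
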